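(* For every odd $n$, $$M(n)\geq\begin{cases}\dfrac{(n+1)^2}{4}, & \text{if } n\equiv 1\pmod 4,\\[2mm] \dfrac{(n+1)^2}{4}-1, & \text{if } n\equiv 3\pmod 4.\end{cases}$$
   Context: $S_n$ is the symmetric group on $[n]=\{1,\dots,n\}$ ($n$ a positive integer). For $\sigma,\pi\in S_n$, $\sigma\cap\pi=\{i\in[n]:\sigma(i)=\pi(i)\}$. A family $\mathcal{F}\subseteq S_n$ is even-intersecting if $|\sigma\cap\pi|$ is even for every two distinct $\sigma,\pi\in\mathcal{F}$. $M(n)=\max\{|\mathcal{F}|:\mathcal{F}\subseteq S_n\text{ is even-intersecting}\}$. *)

(* Defs.v *)
From mathcomp Require Import all_boot all_fingroup.

Set Implicit Arguments.
Unset Strict Implicit.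
Unset Printing Implicit Defensive.

(* The ground set [n] = {1, ..., n} is represented by 'I_n = {0, ..., n-1}. *)

Definition perm_cap (n : nat) (s p : 'S_n) : {set 'I_n} :=
  [set i | s i == p i].

Definition even_intersecting (n : nat) (F : {set 'S_n}) : bool :=
  [forall s in F, forall p in F, (s != p) ==> ~~ odd #|perm_cap s p|].

(* The empty family is even-intersecting, so the maximum is over a nonempty
   set of families and the default value 0 of \max plays no role. *)
Definition M (n : nat) : nat :=
  \max_(F : {set 'S_n} | even_intersecting F) #|F|.

(* Main.v *)
Require Import Defs.
From mathcomp Require Import all_boot all_fingroup.
From mathcomp Require Import zify.

(** The bound comes from two cycles that share a single point.  Cover [n] by
    sets A and B of odd sizes with exactly one common point, let s and t be
    cyclic permutations of A and of B, and take all the products of a power of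
    t followed by a power of s, with exponents below #|B| and #|A|.  Two such
    powers of s with distinct exponents agree exactly outside A, and similarly
    for t and B, so two such products
    - agree exactly on the complement of B if they differ only in the power
      of t;
    - agree at as many points as the complement of A has if they differ only
      in the power of s;
    - never agree if they differ in both powers: outside B the powers of t are
      trivial and those of s differ, while a point of B has two distinct images
      under the powers of t; both are in B, hence not both in A, so that powers
      of s, which preserve A and fix its complement, cannot identify them.
    As n = #|A| + #|B| - 1 is odd, like #|A| and #|B|, these counts are all
    even ([even_card_cap_shifts]).  The products are pairwise distinct because a
    permutation agrees with itself at an odd number of points, so they form a
    family of size #|A| * #|B|.  This product is largest when the two odd
    numbers, whose sum is n + 1, are as close as possible: both equal to
    (n + 1) / 2 if n = 1 mod 4, and equal to (n + 1) / 2 -/+ 1 if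
    n = 3 mod 4. *)

Set Implicit Arguments.
Unset Strict Implicit.
Unset Printing Implicit Defensive.

Local Open Scope nat_scope.

Section Shift.

Variables (T : finType) (A : {set T}).

Definition shift : {perm T} := perm (can_inj (prev_next (enum_uniq A))).

Lemma shiftX_out a x : x \notin A -> (shift ^+ a)%g x = x.
Proof.
move=> xA; rewrite permX; elim: a => //= a ->.
by rewrite permE next_nth mem_enum (negbTE xA).
Qed.

Lemma shiftX_in a x : ((shift ^+ a)%g x \in A) = (x \in A).
Proof.
rewrite permX; elim: a => //= a <-.
by rewrite permE -!(mem_enum A) mem_next.
Qed.

(** The orbit of a point of A under [shift] is all of A, so its first #|A|
    iterates are distinct. *)
Lemma shiftX_inj x a b : x \in A -> a < #|A| -> b < #|A| ->
  (shift ^+ a)%g x = (shift ^+ b)%g x -> a = b.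
Proof.
move=> xA aA bA; rewrite !permX => eq_ab.
have ord_x : fingraph.order shift x = #|A|.
  rewrite cardE; apply: order_cycle; rewrite ?enum_uniq ?mem_enum //.
  rewrite (@eq_fcycle _ _ (next (enum A))); last by move=> y; rewrite permE.
  exact/cycle_next/enum_uniq.
by rewrite -(@findex_iter _ shift x a) ?ord_x // eq_ab findex_iter ?ord_x.
Qed.

Lemma shiftX_eq x a b : a < #|A| -> b < #|A| -> a != b ->
  ((shift ^+ a)%g x == (shift ^+ b)%g x) = (x \notin A).
Proof.
move=> aA bA ab; have [xA|xA] := boolP (x \in A); last first.
  by rewrite !shiftX_out // eqxx.
by apply: contra_neqF ab => /eqP; apply: shiftX_inj.
Qed.

End Shift.

(** Members with distinct indices are distinct, as each agrees with itself at
    all of the n points, an odd number. *)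
Lemma card_index_le_M n (I : finType) (f : I -> 'S_n) : odd n ->
  (forall i j, i != j -> ~~ odd #|perm_cap (f i) (f j)|) -> #|I| <= M n.
Proof.
move=> n_odd even_f.
have f_inj : injective f.
  move=> i j fij; apply/eqP; apply/negPn/negP => /even_f; rewrite fij.
  suff -> : perm_cap (f j) (f j) = setT by rewrite cardsT card_ord n_odd.
  by apply/setP => x; rewrite !inE eqxx.
rewrite -(card_imset predT f_inj).
apply: (@leq_bigmax_cond _ (@even_intersecting n) (fun F => #|F|)).
apply/forallP => s; apply/implyP => /imsetP[i _ ->].
apply/forallP => p; apply/implyP => /imsetP[j _ ->].
by apply/implyP => fij; apply: even_f; apply: contra_neq fij => ->.
Qed.

Section TwoCycles.

Variables (n : nat) (A B : {set 'I_n}).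
Hypotheses (AUB : A :|: B = setT) (AIB : #|A :&: B| = 1)
  (A_odd : odd #|A|) (B_odd : odd #|B|).

Let two_shifts (u : 'I_#|A| * 'I_#|B|) : 'S_n :=
  (shift B ^+ u.2 * shift A ^+ u.1)%g.

Let n_odd : odd n.
Proof. by have := cardsUI A B; rewrite AUB AIB cardsT card_ord; lia. Qed.

Lemma even_card_cap_shifts u v :
  u != v -> ~~ odd #|perm_cap (two_shifts u) (two_shifts v)|.
Proof.
case: u v => [a b] [c d].
have even_compl (X : {set 'I_n}) : odd #|X| -> ~~ odd #|~: X|.
  by have := cardsC X; rewrite card_ord; lia.
have [-> /=|bd] := eqVneq b d.
  have [-> /=|ac _] := eqVneq a c; first by rewrite eqxx.
  suff -> : perm_cap (two_shifts (a, d)) (two_shifts (c, d))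
            = (shift B ^+ d)%g @^-1: ~: A.
    by rewrite -im_permV card_imset ?even_compl //; apply: perm_inj.
  by apply/setP => x; rewrite !inE !permM shiftX_eq.
have [-> _|ac _] := eqVneq a c.
  suff -> : perm_cap (two_shifts (c, b)) (two_shifts (c, d)) = ~: B.
    exact: even_compl.
  by apply/setP => x; rewrite !inE !permM (inj_eq perm_inj) shiftX_eq.
suff -> : perm_cap (two_shifts (a, b)) (two_shifts (c, d)) = set0.
  by rewrite cards0.
apply/setP => x; rewrite !inE !permM /=.
have [xB|xB] := boolP (x \in B); last first.
  have := in_setT x; rewrite -AUB inE (negbTE xB) orbF => xA.
  by rewrite !(shiftX_out _ xB) shiftX_eq // xA.
have: (shift B ^+ b)%g x != (shift B ^+ d)%g x by rewrite shiftX_eq // xB.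
have: (shift B ^+ b)%g x \in B by rewrite shiftX_in.
have: (shift B ^+ d)%g x \in B by rewrite shiftX_in.
(* At most one of the two images can be the common point of A and B. *)
move: {x xB} (_ x) (_ x) => z y yB zB zy.
apply: contraNF zy => /eqP eq_zy.
have zyA : (z \in A) = (y \in A).
  by rewrite -(shiftX_in A a z) eq_zy shiftX_in.
have [yA|yA] := boolP (y \in A); last first.
  by move: eq_zy; rewrite !shiftX_out ?zyA // => ->.
have /card_le1_eqP AIB1 : #|A :&: B| <= 1 by rewrite AIB.
by apply/eqP; apply: AIB1; rewrite inE ?zyA yA.
Qed.

Lemma card_mul_le_M : #|A| * #|B| <= M n.
Proof.
have := card_index_le_M n_odd even_card_cap_shifts.
by rewrite card_prod !card_ord.
Qed.

End TwoCycles.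

(** Here n = p + q: the second cycle has length q.+1 because it permutes the
    complement of the first one together with the common point. *)
Lemma odd_mul_le_M p q : odd p -> ~~ odd q -> p * q.+1 <= M (p + q).
Proof.
move=> p_odd q_even; have p_gt0 : 0 < p by case: p p_odd.
pose A := [set lshift q i | i : 'I_p].
pose z := lshift q (Ordinal p_gt0); pose B := z |: ~: A.
have zA : z \in A by apply: imset_f.
have cardA : #|A| = p by rewrite card_imset ?card_ord //; apply: lshift_inj.
have cardB : #|B| = q.+1.
  rewrite cardsU1 !inE zA /=.
  by have := cardsC A; rewrite card_ord cardA => /addnI ->.
rewrite -{1}cardA -cardB; apply: card_mul_le_M; rewrite ?cardA ?cardB //.
  by rewrite /B setUCA setUCr setUT.
by rewrite /B setIUr setICr setU0 (setIidPr _) ?sub1set // cards1.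
Qed.

Theorem theorem2 (n : nat) (n_odd : odd n) :
  (n = 1 %[mod 4] -> (n + 1) ^ 2 %/ 4 <= M n) /\
  (n = 3 %[mod 4] -> (n + 1) ^ 2 %/ 4 - 1 <= M n).
Proof.
split=> nmod; have := divn_eq n 4; rewrite nmod => ->;
  move: (n %/ 4) => j; rewrite /= !modn_small //.
  have -> : j * 4 + 1 = (j * 2).+1 + j * 2 by lia.
  by apply: leq_trans (odd_mul_le_M _ _); lia.
have -> : j * 4 + 3 = (j * 2).+1 + (j * 2).+2 by lia.
by apply: leq_trans (odd_mul_le_M _ _); lia.
Qed.
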